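(* Let $(X,\mathcal{T})$ be an $L$-fuzzy topological space. An $L$-subset $G\in L^X$ is $L$-fuzzy SP-compact if and only if for every family $\mathcal{W}\subseteq L^X$, $$\bigvee_{F\in\mathcal{W}}(\mathcal{T}^*_{sp}(F))'\vee\bigvee_{x\in X}\Big(G(x)\wedge\bigwedge_{F\in\mathcal{W}}F(x)\Big)\ \ge\ \bigwedge_{\mathcal{H}\in 2^{(\mathcal{W})}}\bigvee_{x\in X}\Big(G(x)\wedge\bigwedge_{F\in\mathcal{H}}F(x)\Big).$$
   Context: $L$ is a completely distributive complete lattice with least element $\bot$, greatest element $\top$ and an order-reversing involution $'$ (a completely distributive De Morgan algebra). $X$ is a nonempty set; $L^X$ is the set of all $L$-subsets (maps $X\to L$), with pointwise order, joins, meets and complement $A'(x)=A(x)'$; $\underline{\bot},\underline{\top}$ are its least and greatest elements. An element $a\in L$ is co-prime if $a\le b\vee c$ implies $a\le b$ or $a\le c$; $M(L)$ is the set of co-prime elements $\neq\bot$. In a complete lattice, $a\ll b$ means: for every subset $D$, $b\le\bigvee D$ implies $a\le d$ for some $d\in D$. For $x\in X$, $\lambda\in M(L)$, $x_\lambda\in L^X$ is the $L$-fuzzy point with value $\lambda$ at $x$ and $\bot$ elsewhere; $x_\lambda\ll A$ refers to $\ll$ in $L^X$. An $L$-fuzzy topology on $X$ is a map $\mathcal{T}:L^X\to L$ with $\mathcal{T}(\underline\bot)=\mathcal{T}(\underline\top)=\top$, $\mathcal{T}(A\wedge B)\ge\mathcal{T}(A)\wedge\mathcal{T}(B)$, and $\mathcal{T}(\bigvee_i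 A_i)\ge\bigwedge_i\mathcal{T}(A_i)$; $(X,\mathcal{T})$ is an $L$-fuzzy topological space. The $L$-fuzzy preopen operator is $$\mathcal{T}_p(A)=\bigwedge_{x_\lambda\ll A}\ \bigvee_{B:\,x_\lambda\ll B}\Big\{\mathcal{T}(B)\wedge\bigwedge_{y_\mu\ll B}\ \bigwedge_{D:\,y_\mu\not\le D\ge A}(\mathcal{T}(D'))'\Big\},$$ and the $L$-fuzzy Semi-Preopen operator is $$\mathcal{T}_{sp}(A)=\bigvee_{B\le A}\Big\{\mathcal{T}_p(B)\wedge\bigwedge_{x_\lambda\ll A}\ \bigwedge_{D:\,x_\lambda\not\le D\ge B}(\mathcal{T}(D'))'\Big\},$$ where $B,D$ range over $L^X$. Put $\mathcal{T}_{sp}^*(A)=\mathcal{T}_{sp}(A')$. $2^{(\mathcal{P})}$ denotes the set of all finite subfamilies of $\mathcal{P}$. $G\in L^X$ is $L$-fuzzy SP-compact in $(X,\mathcal{T})$ if for every family $\mathcal{P}\subseteq L^X$, $$\bigwedge_{F\in\mathcal{P}}\mathcal{T}_{sp}(F)\wedge\bigwedge_{x\in X}\Big(G'(x)\vee\bigvee_{F\in\mathcal{P}}F(x)\Big)\le\bigvee_{\mathcal{Q}\in 2^{(\mathcal{P})}}\bigwedge_{x\in X}\Big(G'(x)\vee\bigvee_{F\in\mathcal{Q}}F(x)\Big).$$ *)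

(* Defs.v *)
From HB Require Import structures.
From mathcomp Require Import all_boot all_order.
From mathcomp Require Import boolp classical_sets functions cardinality.

Set Implicit Arguments.
Unset Strict Implicit.
Unset Printing Implicit Defensive.

Import Order.TTheory.

Local Open Scope classical_set_scope.
Local Open Scope order_scope.

HB.mixin Record TBLattice_isComplete d T of Order.TBLattice d T := {
  csup : set T -> T;
  cinf : set T -> T;
  csupP : forall A : set T, isLub A (csup A);
  cinfP : forall A : set T,
    lbound A (cinf A) /\ forall b, lbound A b -> b <= cinf A
}.

#[short(type="completeLatticeType")]
HB.structure Definition CompleteLattice d :=
  { T of TBLattice_isComplete d T & Order.TBLattice d T }.

Arguments csup {d T} : rename.
Arguments cinf {d T} : rename.

Notation "\csup_ ( i 'in' A ) F" := (csup [set F | i in A])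
  (at level 41, F at level 41, i, A at level 50) : order_scope.
Notation "\cinf_ ( i 'in' A ) F" := (cinf [set F | i in A])
  (at level 41, F at level 41, i, A at level 50) : order_scope.

(* The distributive law is stated for families of subsets A_i, i in I:
   inf_i sup A_i is the supremum, over the choice functions f in prod_i A_i,
   of inf_i f(i).  The involution a |-> a' is [neg]. *)
HB.mixin Record CompleteLattice_isCDDeMorgan d T of CompleteLattice d T := {
  csup_cinf_distr : forall (I : Type) (A : I -> set T),
    \cinf_(i in [set: I]) csup (A i) =
    \csup_(f in [set f : I -> T | forall i, A i (f i)])
      \cinf_(i in [set: I]) f i;
  neg : T -> T;
  negK : involutive neg;
  neg_anti : forall a b : T, a <= b -> neg b <= neg a
}.

#[short(type="cdDeMorganType")]
HB.structure Definition CDDeMorgan d :=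
  { T of CompleteLattice_isCDDeMorgan d T & CompleteLattice d T }.

Arguments neg {d T} : rename.

Lemma fun_le0 X d (L : tbLatticeType d) (A : X -> L) : (fun=> \bot) <= A.
Proof. by apply/lefP => x; exact: le0x. Qed.

Lemma fun_le1 X d (L : tbLatticeType d) (A : X -> L) : A <= (fun=> \top).
Proof. by apply/lefP => x; exact: lex1. Qed.

HB.instance Definition _ X d (L : tbLatticeType d) :=
  Order.hasBottom.Build _ (X -> L) (@fun_le0 X d L).
HB.instance Definition _ X d (L : tbLatticeType d) :=
  Order.hasTop.Build _ (X -> L) (@fun_le1 X d L).

Definition fun_csup X d (L : completeLatticeType d) (D : set (X -> L)) : X -> L :=
  fun x => \csup_(A in D) A x.

Definition fun_cinf X d (L : completeLatticeType d) (D : set (X -> L)) : X -> L :=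
  fun x => \cinf_(A in D) A x.

Lemma fun_csupP X d (L : completeLatticeType d) (D : set (X -> L)) :
  isLub D (fun_csup D).
Proof.
split=> [A DA|B BD]; apply/lefP => x; have [ub lub] := csupP [set A x | A in D].
  by apply: ub; exists A.
by apply: lub => _ [A DA <-]; have /lefP := BD _ DA; apply.
Qed.

Lemma fun_cinfP X d (L : completeLatticeType d) (D : set (X -> L)) :
  lbound D (fun_cinf D) /\ forall B, lbound D B -> B <= fun_cinf D.
Proof.
split=> [A DA|B BD]; apply/lefP => x; have [lb glb] := cinfP [set A x | A in D].
  by apply: lb; exists A.
by apply: glb => _ [A DA <-]; have /lefP := BD _ DA; apply.
Qed.

HB.instance Definition _ X d (L : completeLatticeType d) :=
  TBLattice_isComplete.Build _ (X -> L) (@fun_csupP X d L) (@fun_cinfP X d L).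

Definition fneg d (L : cdDeMorganType d) X (A : X -> L) : X -> L :=
  fun x => neg (A x).

(* D is an arbitrary subset, not only a directed one as in the usual way-below
   relation of domain theory. *)
Definition way_below d (T : completeLatticeType d) (a b : T) : Prop :=
  forall D : set T, b <= csup D -> exists2 c, D c & a <= c.

Definition coprime_elt d (L : completeLatticeType d) (a : L) : Prop :=
  forall b c : L, a <= b `|` c -> a <= b \/ a <= c.

Definition coprimes d (L : completeLatticeType d) : set L :=
  [set a | coprime_elt a /\ a <> \bot].

Definition fpoint d (L : completeLatticeType d) X (x : X) (l : L) : X -> L :=
  fun y => if `[< y = x >] then l else \bot.

(* The points are used only through the L-subset x_lambda, so that an index
   "x_lambda << A" ranges over a set of L-subsets. *)
Definition fpoints_below d (L : completeLatticeType d) X (A : X -> L) :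
    set (X -> L) :=
  [set e | way_below e A /\ exists x l, coprimes l /\ e = fpoint x l].

Record fuzzy_topology d (L : cdDeMorganType d) X (T : (X -> L) -> L) : Prop :=
  FuzzyTopology {
    ftop_bot : T \bot = \top;
    ftop_top : T \top = \top;
    ftop_meet : forall A B : X -> L, T A `&` T B <= T (A `&` B);
    ftop_csup : forall (I : Type) (A : I -> X -> L),
      \cinf_(i in [set: I]) T (A i) <= T (\csup_(i in [set: I]) A i)
  }.

Definition preopen d (L : cdDeMorganType d) X (T : (X -> L) -> L)
    (A : X -> L) : L :=
  \cinf_(e in fpoints_below A)
    \csup_(B in [set B : X -> L | way_below e B])
      (T B `&`
       \cinf_(u in fpoints_below B)
         \cinf_(D in [set D : X -> L | ~ u <= D /\ A <= D]) neg (T (fneg D))).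

Definition semi_preopen d (L : cdDeMorganType d) X (T : (X -> L) -> L)
    (A : X -> L) : L :=
  \csup_(B in [set B : X -> L | B <= A])
    (preopen T B `&`
     \cinf_(e in fpoints_below A)
       \cinf_(D in [set D : X -> L | ~ e <= D /\ B <= D]) neg (T (fneg D))).

Definition semi_preclosed d (L : cdDeMorganType d) X (T : (X -> L) -> L)
    (A : X -> L) : L :=
  semi_preopen T (fneg A).

Definition finite_subfamilies X (P : set X) : set (set X) :=
  [set Q | Q `<=` P /\ finite_set Q].

Definition sp_compact d (L : cdDeMorganType d) X (T : (X -> L) -> L)
    (G : X -> L) : Prop :=
  forall P : set (X -> L),
    (\cinf_(F in P) semi_preopen T F) `&`
      (\cinf_(x in [set: X]) (fneg G x `|` \csup_(F in P) F x))
    <= \csup_(Q in finite_subfamilies P)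
         \cinf_(x in [set: X]) (fneg G x `|` \csup_(F in Q) F x).

(* Main.v *)
(** Complementation is an order anti-automorphism of [L], so it turns the
    compactness inequality of a family [P] into the dual inequality of the
    family of complements of the members of [P]; complementation is a bijection
    on families of [L]-subsets which preserves finiteness. *)
Require Import Defs.
From mathcomp Require Import all_boot all_order.
From mathcomp Require Import boolp classical_sets functions cardinality.

Import Order.TTheory.

Local Open Scope classical_set_scope.
Local Open Scope order_scope.

Section Complement.
Context {d : Order.disp_t} {L : cdDeMorganType d}.
Implicit Types a b : L.

Lemma neg_le a b : (neg a <= neg b) = (b <= a).
Proof.
by apply/idP/idP => /neg_anti //; rewrite !negK.
Qed.

Lemma neg_lel a b : (neg a <= b) = (neg b <= a).
Proof. by rewrite -[in LHS](negK b) neg_le. Qed.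

(** [neg] forms an antitone Galois connection with itself; moving it across an inequality carries
    the universal property of joins and suprema to that of meets and infima. *)
Lemma neg_ler a b : (a <= neg b) = (b <= neg a).
Proof. by rewrite -[in LHS](negK a) neg_le. Qed.

Lemma neg_join a b : neg (a `|` b) = neg a `&` neg b.
Proof.
apply/le_anti; rewrite lexI !neg_le leUl leUr /=.
by rewrite neg_ler leUx !(neg_ler _ (neg a `&` neg b)) leIl leIr.
Qed.

Lemma neg_meet a b : neg (a `&` b) = neg a `|` neg b.
Proof. by rewrite -[RHS]negK neg_join !negK. Qed.

Lemma neg_csup I (A : set I) (F : I -> L) :
  neg (\csup_(i in A) F i) = \cinf_(i in A) neg (F i).
Proof.
have [ubF lubF] := csupP [set F i | i in A].
have [lbN glbN] := cinfP [set neg (F i) | i in A].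
apply/le_anti/andP; split.
  by apply: glbN => _ [i Ai <-]; rewrite neg_le; apply: ubF; exists i.
rewrite neg_ler; apply: lubF => _ [i Ai <-].
by rewrite neg_ler; apply: lbN; exists i.
Qed.

Lemma neg_cinf I (A : set I) (F : I -> L) :
  neg (\cinf_(i in A) F i) = \csup_(i in A) neg (F i).
Proof.
rewrite -[RHS]negK neg_csup; congr (neg (cinf _)).
by apply: eq_imagel => i _; rewrite negK.
Qed.

Lemma fnegK X : involutive (@fneg d L X).
Proof. by move=> A; apply/funext => x; rewrite /fneg negK. Qed.

End Complement.

(** A finite subfamily [Q] of the image lifts to [W] by choosing one preimage of each member: the
    chosen preimages form a finite set whose image is [Q]. *)
Lemma finite_subfamilies_image X Y (f : X -> Y) (W : set X) :
  finite_subfamilies (f @` W) = image ^~ f @` finite_subfamilies W.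
Proof.
apply/seteqP; split=> [Q [QW finQ]|_ [H [HW finH] <-]]; last first.
  by split; [exact: image_subset | exact: finite_image].
have [H [HW fH finH]] : exists H, [/\ H `<=` W, f @` H = Q & finite_set H].
  (* A nonempty [Q] supplies a preimage [x0], the default value of the choice function outside [Q];
     the empty [Q] lifts to [set0]. *)
  have [[y Qy]|/set0P/negP/negPn/eqP ->] := pselect (Q !=set0); last first.
    by exists set0; split; [exact: sub0set | exact: image_set0 | exact: finite_set0].
  have [x0 _ _] := QW _ Qy.
  have /choice [g gP] z : exists x, Q z -> W x /\ f x = z.
    have [/QW[x Wx fx]|nQz] := pselect (Q z); first by exists x.
    by exists x0.
  exists (g @` Q); split; last exact: finite_image.
    by move=> _ [z Qz <-]; exact: (gP z Qz).1.
  rewrite image_comp -[RHS]image_id.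
  by apply: eq_imagel => z Qz; exact: (gP z Qz).2.
by exists H.
Qed.

(** Stated for a single pair of families, with [P] given by an equation, so that either family can
    be the prescribed one. *)
Lemma sp_compact_dual {d} {L : cdDeMorganType d} {X} (T : (X -> L) -> L)
    (G : X -> L) {P W : set (X -> L)} : P = @fneg d L X @` W ->
  ((\cinf_(F in P) semi_preopen T F) `&`
      (\cinf_(x in [set: X]) (fneg G x `|` \csup_(F in P) F x))
    <= \csup_(Q in finite_subfamilies P)
         \cinf_(x in [set: X]) (fneg G x `|` \csup_(F in Q) F x)) =
  (\cinf_(H in finite_subfamilies W)
         \csup_(x in [set: X]) (G x `&` \cinf_(F in H) F x) <=
  (\csup_(F in W) neg (semi_preclosed T F)) `|`
      (\csup_(x in [set: X]) (G x `&` \cinf_(F in W) F x))).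
Proof.
move=> ->.
(* De Morgan duality for an arbitrary family, needed both for [W] and for each of its finite
   subfamilies. *)
have dualE (H : set (X -> L)) :
    \cinf_(x in [set: X]) (fneg G x `|` \csup_(F in @fneg d L X @` H) F x) =
    neg (\csup_(x in [set: X]) (G x `&` \cinf_(F in H) F x)).
  rewrite neg_csup; congr cinf; apply: eq_imagel => x _.
  by rewrite neg_meet neg_cinf image_comp.
rewrite finite_subfamilies_image !image_comp.
(* Complementing both sides reverses the dual inequality, whose terms then match those of the
   compactness inequality one by one. *)
rewrite -[RHS]neg_le neg_join neg_csup neg_cinf -dualE.
congr (_ `&` _ <= _); congr (_ _); apply: eq_imagel => F _.
  by rewrite negK.
exact: dualE.
Qed.

Theorem theorem4p1 (d : Order.disp_t) (L : cdDeMorganType d) (X : Type)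
    (hX : inhabited X) (T : (X -> L) -> L) (hT : fuzzy_topology T)
    (G : X -> L) :
  sp_compact T G <->
  forall W : set (X -> L),
    (\csup_(F in W) neg (semi_preclosed T F)) `|`
      (\csup_(x in [set: X]) (G x `&` \cinf_(F in W) F x))
    >= \cinf_(H in finite_subfamilies W)
         \csup_(x in [set: X]) (G x `&` \cinf_(F in H) F x).
Proof.
split=> [cG W|cG P]; first by rewrite -(sp_compact_dual T G erefl); exact: cG.
(* [P] is the family of complements of its own complements. *)
rewrite (sp_compact_dual T G (W := @fneg d L X @` P)) ?cG//.
rewrite image_comp -[LHS]image_id; apply: eq_imagel => F _.
by rewrite /= fnegK.
Qed.
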